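(* Let $\lambda$ be a nonzero real number and $r$ a positive integer. For every integer $n\ge0$, the generalized degenerate harmonic numbers satisfy $$H_{\lambda}(n+r+1,r)=\sum_{l=r+1}^{n+r+1}(-1)^{r+1-l}\sum_{l_{1}+\cdots+l_{r+1}=l}\frac{\lambda^{l-r-1}(1)_{l_{1},1/\lambda}\cdots(1)_{l_{r+1},1/\lambda}}{l_{1}!\cdots l_{r+1}!},$$ where the inner sum is over all $(r+1)$-tuples of positive integers $(l_1,\dots,l_{r+1})$ with $l_1+\cdots+l_{r+1}=l$.
   Context: All generating functions are formal power series in $t$ with real coefficients. For real $\mu$ and $x$: $(x)_{0,\mu}=1$, $(x)_{k,\mu}=x(x-\mu)\cdots(x-(k-1)\mu)$ for $k\ge1$; thus $(1)_{k,1/\lambda}=\prod_{j=0}^{k-1}(1-j/\lambda)$. The degenerate logarithm is $\log_\lambda(1+t)=\frac{1}{\lambda}\left((1+t)^\lambda-1\right)$. The generalized degenerate harmonic numbers $H_\lambda(n+r+1,r)$ ($n\ge0$) are defined by $\sum_{n\ge0}H_\lambda(n+r+1,r)t^n=\frac{\left(-\log_\lambda(1-t)\right)^{r+1}}{t^{r+1}(1-t)}$. *)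

(* Defs.v *)
From HB Require Import structures.
From mathcomp Require Import all_boot all_order all_algebra.
From mathcomp Require Import boolp classical_sets reals.

Set Implicit Arguments.
Unset Strict Implicit.
Unset Printing Implicit Defensive.

Import Order.TTheory GRing.Theory Num.Theory.

Local Open Scope ring_scope.

(* A wrapper around [nat -> R] is needed because functions already carry the
   pointwise product. *)
Record fps (R : Type) := Fps { fps_coef : nat -> R }.

HB.instance Definition _ (R : Type) := gen_eqMixin (fps R).
HB.instance Definition _ (R : Type) := gen_choiceMixin (fps R).

Lemma fpsP (R : Type) (f g : fps R) :
  (forall n, fps_coef f n = fps_coef g n) -> f = g.
Proof. by case: f g => [f] [g] /= fg; congr Fps; apply/funext. Qed.

Section FpsRing.
Variable R : comNzRingType.
Implicit Types f g h : fps R.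

Definition fps_zero : fps R := Fps (fun=> 0).
Definition fps_one : fps R := Fps (fun n => (n == 0%N)%:R).
Definition fps_opp f : fps R := Fps (fun n => - fps_coef f n).
Definition fps_add f g : fps R := Fps (fun n => fps_coef f n + fps_coef g n).
Definition fps_mul f g : fps R :=
  Fps (fun n => \sum_(i < n.+1) fps_coef f i * fps_coef g (n - i)).

Let fps_addA : associative fps_add.
Proof. by move=> f g h; apply: fpsP => n /=; rewrite addrA. Qed.

Let fps_addC : commutative fps_add.
Proof. by move=> f g; apply: fpsP => n /=; rewrite addrC. Qed.

Let fps_add0 : left_id fps_zero fps_add.
Proof. by move=> f; apply: fpsP => n /=; rewrite add0r. Qed.

Let fps_addN : left_inverse fps_zero fps_opp fps_add.
Proof. by move=> f; apply: fpsP => n /=; rewrite addNr. Qed.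

HB.instance Definition _ :=
  GRing.isZmodule.Build (fps R) fps_addA fps_addC fps_add0 fps_addN.

Let trunc m f : {poly R} := \poly_(i < m) fps_coef f i.

Let coef_trunc m f n : (n < m)%N -> (trunc m f)`_n = fps_coef f n.
Proof. by move=> nm; rewrite coef_poly nm. Qed.

Let trunc_mul m f g n : (n < m)%N ->
  (trunc m f * trunc m g)`_n = fps_coef (fps_mul f g) n.
Proof.
move=> nm; rewrite coefM; apply: eq_bigr => -[i /= lin] _.
rewrite !coef_trunc //; first exact: leq_ltn_trans (leq_subr _ _) nm.
exact: leq_trans lin nm.
Qed.

Let fps_mulC : commutative fps_mul.
Proof.
by move=> f g; apply: fpsP => n; rewrite -!(@trunc_mul n.+1) // mulrC.
Qed.

Let fps_mulA : associative fps_mul.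
Proof.
move=> f g h; apply: fpsP => n.
have -> : fps_coef (fps_mul f (fps_mul g h)) n
          = (trunc n.+1 f * (trunc n.+1 g * trunc n.+1 h))`_n.
  rewrite coefM; apply: eq_bigr => -[i /= lin] _.
  by rewrite coef_trunc // (@trunc_mul n.+1) // ltnS leq_subr.
rewrite mulrA coefM; apply: eq_bigr => -[i /= lin] _.
by rewrite (@trunc_mul n.+1) // coef_trunc // ltnS leq_subr.
Qed.

Let fps_mul1 : left_id fps_one fps_mul.
Proof.
move=> f; apply: fpsP => n /=.
rewrite big_ord_recl /= mul1r subn0 big1 ?addr0 // => i _.
by rewrite mul0r.
Qed.

Let fps_mulD : left_distributive fps_mul fps_add.
Proof.
move=> f g h; apply: fpsP => n /=.
by rewrite -big_split; apply: eq_bigr => i _ /=; rewrite mulrDl.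
Qed.

Let fps_one_neq0 : fps_one != 0.
Proof.
apply/eqP => /(congr1 (fun f => fps_coef f 0)) /= /eqP.
by rewrite oner_eq0.
Qed.

HB.instance Definition _ := GRing.Zmodule_isComNzRing.Build (fps R)
  fps_mulA fps_mulC fps_mul1 fps_mulD fps_one_neq0.

Definition fpsX : fps R := Fps (fun n => (n == 1%N)%:R).

(* [fps_scale c f] is c f(t). *)
Definition fps_scale (c : R) f : fps R := Fps (fun n => c * fps_coef f n).

(* [fps_dilate a f] is f(a t). *)
Definition fps_dilate (a : R) f : fps R := Fps (fun n => a ^+ n * fps_coef f n).

(* The quotient f / g, that is, the series q with g q = f, when g divides f and
   is not a zero divisor; g need not be invertible, e.g. g = t^k. *)
Definition fps_div f g : fps R := xget 0 [set q | g * q = f]%classic.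

Lemma coef_fps1 n : fps_coef (1 : fps R) n = (n == 0%N)%:R.
Proof. by []. Qed.

Lemma coef_fpsN f n : fps_coef (- f) n = - fps_coef f n.
Proof. by []. Qed.

Lemma coef_fpsD f g n : fps_coef (f + g) n = fps_coef f n + fps_coef g n.
Proof. by []. Qed.

Lemma coef_fpsM f g n :
  fps_coef (f * g) n = \sum_(i < n.+1) fps_coef f i * fps_coef g (n - i).
Proof. by []. Qed.

Lemma coef_fpsXM f n : fps_coef (fpsX * f) n.+1 = fps_coef f n.
Proof.
rewrite coef_fpsM !big_ord_recl /= mul0r add0r mul1r subSS subn0.
by rewrite big1 ?addr0 // => i _; rewrite mul0r.
Qed.

Lemma fpsX_mulI : injective ( *%R fpsX).
Proof.
move=> f g fg; apply: fpsP => n.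
by rewrite -(coef_fpsXM f) fg coef_fpsXM.
Qed.

Lemma fps_geom : (1 - fpsX) * Fps (fun=> 1) = 1.
Proof.
apply: fpsP => -[|n]; rewrite mulrBl mul1r /=.
  by rewrite big_ord1 /= mul0r subr0.
by rewrite [X in _ - X](coef_fpsXM (Fps (fun=> 1)) n) /= subrr.
Qed.

Lemma fps_factorX f : fps_coef f 0 = 0 ->
  f = fpsX * Fps (fun n => fps_coef f n.+1).
Proof.
move=> f0; apply: fpsP => -[|n]; last by rewrite coef_fpsXM.
by rewrite coef_fpsM big_ord1 /= mul0r.
Qed.

Lemma fpsXn1X_mulI k : injective ( *%R (fpsX ^+ k * (1 - fpsX))).
Proof.
elim: k => [|k IH] f g /=.
  rewrite expr0 mul1r => /(congr1 ( *%R (Fps (fun=> 1)))) /=.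
  by rewrite !mulrA (mulrC (Fps (fun=> 1))) fps_geom !mul1r.
by rewrite exprS -(mulrA fpsX) -!(mulrA fpsX (_ * _)) => /fpsX_mulI /IH.
Qed.

End FpsRing.

Arguments fpsX {R}.

Section Degenerate.
Variable R : realType.
Implicit Types (mu x lam : R).

(* (x)_{k,mu} *)
Definition dfall x mu (k : nat) : R := \prod_(j < k) (x - j%:R * mu).

(* (1 + t)^lam, the binomial series. *)
Definition binom_series lam : fps R :=
  Fps (fun k => dfall lam 1 k / (k`!)%:R).

(* log_lam(1 + t) *)
Definition dlog1p lam : fps R := fps_scale lam^-1 (binom_series lam - 1).

(* (- log_lam(1 - t))^(r+1) / (t^(r+1) (1 - t)) *)
Definition gdharm_series lam (r : nat) : fps R :=
  fps_div ((- fps_dilate (-1) (dlog1p lam)) ^+ r.+1)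
          (fpsX ^+ r.+1 * (1 - fpsX)).

(* H_lam(m, r), meaningful for m >= r + 1: the generating function is indexed
   by n = m - (r + 1). *)
Definition gdharm lam (m r : nat) : R := fps_coef (gdharm_series lam r) (m - r.+1).

(* The quotient in [gdharm_series] exists; it is unique by [fpsXn1X_mulI]. *)
Lemma gdharm_genfun lam r :
  fpsX ^+ r.+1 * (1 - fpsX) * Fps (fun n => gdharm lam (n + r + 1) r)
  = (- fps_dilate (-1) (dlog1p lam)) ^+ r.+1.
Proof.
have -> : Fps (fun n => gdharm lam (n + r + 1) r) = gdharm_series lam r.
  by apply: fpsP => n; rewrite /= /gdharm -addnA addn1 addnK.
rewrite /gdharm_series /fps_div.
set f := - fps_dilate _ _; set P := [set q | _]%classic; apply: (@xgetPex _ _ P).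
have f0 : fps_coef f 0 = 0.
  have b0 : fps_coef (binom_series lam) 0 = 1.
    by rewrite /= /dfall big_ord0 fact0 divr1.
  have l0 : fps_coef (dlog1p lam) 0 = 0.
    transitivity (lam^-1 * (fps_coef (binom_series lam) 0 - 1)) => //.
    by rewrite b0 subrr mulr0.
  transitivity (- ((-1) ^+ 0 * fps_coef (dlog1p lam) 0)) => //.
  by rewrite l0 mulr0 oppr0.
exists (Fps (fun n => fps_coef f n.+1) ^+ r.+1 * Fps (fun=> 1)).
rewrite /P /= mulrACA fps_geom mulr1 -exprMn.
by rewrite -(fps_factorX f0).
Qed.

End Degenerate.

(* Main.v *)
Require Import Defs.
From mathcomp Require Import all_boot all_order all_algebra.
From mathcomp Require Import reals.

Import Order.TTheory GRing.Theory Num.Theory.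

Local Open Scope ring_scope.

(** Since [(lam)_k = lam^k (1)_(k,1/lam)], the series [- log_lam(1 - t)] has
   coefficients [(-lam)^(k-1) (1)_(k,1/lam) / k!] for [k >= 1] and no constant
   term.  The inner sum of the theorem is, up to sign, the coefficient of [t^l]
   in its [(r+1)]-st power; dividing by [1 - t] takes partial sums of the
   coefficients, and dividing by [t^(r+1)] shifts them. *)

(** A Cauchy product in degree at most [l] only sees factors of degree at most [l]; this reduces
    powers of series to powers of polynomials. *)
Lemma coef_trunc_exp (R : comNzRingType) (f : fps R) (l m i : nat) :
  (i <= l)%N ->
  ((\poly_(k < l.+1) fps_coef f k) ^+ m)`_i = fps_coef (f ^+ m) i.
Proof.
elim: m i => [|m IH] i il; first by rewrite !expr0 coef1 coef_fps1.
rewrite !exprS coefM coef_fpsM; apply: eq_bigr => -[j /= ji] _.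
have jl : (j <= l)%N by rewrite (leq_trans _ il) // -ltnS.
by rewrite coef_poly ltnS jl IH // (leq_trans (leq_subr _ _) il).
Qed.

Lemma coef_fps_exp (R : comNzRingType) (f : fps R) (m l : nat) :
  fps_coef (f ^+ m) l =
  \sum_(s : {ffun 'I_m -> 'I_l.+1} | (\sum_i (s i : nat) == l)%N)
    \prod_i fps_coef f (s i).
Proof.
(* The power becomes a product over ['I_m] of finite sums; distributing it, each choice [s] gives
   one monomial, of degree the sum of the [s i]. *)
rewrite -(@coef_trunc_exp _ f l) // poly_def -[X in _ ^+ X]card_ord.
rewrite -prodr_const bigA_distr_bigA /= coef_sum [RHS]big_mkcond /=.
apply: eq_bigr => s _.
rewrite (eq_bigr (fun i => (fps_coef f (s i))%:P * 'X ^+ (s i))); last first.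
  by move=> i _; rewrite mul_polyC.
rewrite big_split /= prodrXr -rmorph_prod coefCM coefXn eq_sym.
by case: eqP; rewrite ?mulr1 ?mulr0.
Qed.

Lemma coef_fpsXnM (R : comNzRingType) (k : nat) (f : fps R) (n : nat) :
  fps_coef (fpsX ^+ k * f) (n + k) = fps_coef f n.
Proof.
elim: k => [|k IH]; first by rewrite expr0 mul1r addn0.
by rewrite exprS -mulrA addnS coef_fpsXM.
Qed.

Lemma coef_fps_partial_sum (R : comNzRingType) (g : fps R) (n : nat) :
  fps_coef g n = \sum_(i < n.+1) fps_coef ((1 - fpsX) * g) i.
Proof.
have {1}-> : g = (1 - fpsX) * g * Fps (fun=> 1) by rewrite mulrAC fps_geom mul1r.
by rewrite coef_fpsM; apply: eq_bigr => i _; rewrite mulr1.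
Qed.

Lemma dfall_scale (R : realType) (lam : R) (k : nat) :
  lam != 0 -> dfall lam 1 k = lam ^+ k * dfall 1 lam^-1 k.
Proof.
move=> lam0; rewrite /dfall -[X in lam ^+ X]card_ord -prodr_const -big_split.
by apply: eq_bigr => j _ /=; rewrite mulrBr mulrCA divff // !mulr1.
Qed.

Lemma coef_dlog1p0 (R : realType) (lam : R) :
  fps_coef (- fps_dilate (-1) (dlog1p lam)) 0 = 0.
Proof.
rewrite -[LHS]/(- ((-1) ^+ 0 * (lam^-1 * (dfall lam 1 0 / 0`!%:R - 1)))).
by rewrite /dfall big_ord0 fact0 divr1 subrr !mulr0 oppr0.
Qed.

Lemma coef_dlog1pS (R : realType) (lam : R) (k : nat) : lam != 0 ->
  fps_coef (- fps_dilate (-1) (dlog1p lam)) k.+1 =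
  (-1) ^+ k * (lam ^+ k * dfall 1 lam^-1 k.+1 / (k.+1)`!%:R).
Proof.
move=> lam0.
(* The [0] is the coefficient of the series [1] in positive degree. *)
rewrite -[LHS]/(- ((-1) ^+ k.+1 *
  (lam^-1 * (dfall lam 1 k.+1 / (k.+1)`!%:R - 0)))).
rewrite subr0 dfall_scale // exprS mulN1r mulNr opprK.
by rewrite [lam ^+ k.+1]exprS -!mulrA mulKf.
Qed.

(** The truncated [l - m] is harmless: for [l < m] no tuple of positive parts sums to [l], and both
    sides vanish. *)
Lemma coef_dlog1p_exp (R : realType) (lam : R) (m l : nat) : lam != 0 ->
  fps_coef ((- fps_dilate (-1) (dlog1p lam)) ^+ m) l =
  (-1) ^+ (l - m) *
  \sum_(s : {ffun 'I_m -> 'I_l.+1} |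
          [forall i, (0 < s i)%N] && (\sum_i (s i : nat) == l)%N)
    (lam ^+ (l - m) * \prod_i dfall 1 lam^-1 (s i)) / \prod_i ((s i)`!)%:R.
Proof.
move=> lam0.
move: (- fps_dilate _ _) (coef_dlog1p0 _ lam)
  (fun k => coef_dlog1pS _ lam k lam0).
move=> f f0 fS; rewrite coef_fps_exp big_distrr /=.
rewrite (bigID (fun s : {ffun 'I_m -> 'I_l.+1} => [forall i, (0 < s i)%N])) /=.
(* A tuple with a zero part contributes nothing, as [f] has no constant term. *)
rewrite [X in _ + X]big1 ?addr0 => [|s /andP[_]]; last first.
  rewrite negb_forall => /existsP[i]; rewrite -eqn0Ngt => /eqP si0.
  by rewrite (bigD1 i) //= si0 f0 mul0r.
apply: eq_big => [s|s /andP[sl /forallP s0]]; first by rewrite andbC.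
(* This is the total exponent of both [-1] and [lam] in the product of the coefficients. *)
have lm : (\sum_i (s i).-1 = l - m)%N.
  transitivity (\sum_i (s i : nat) - m)%N; last by rewrite (eqP sl).
  rewrite -[X in (_ - X)%N]card_ord -sum1_card -sumnB //.
  by apply: eq_bigr => i _; rewrite subn1.
rewrite (eq_bigr (fun i => (-1) ^+ (s i).-1 * (lam ^+ (s i).-1 *
    dfall 1 lam^-1 (s i) / (s i)`!%:R))); last first.
  by move=> i _; rewrite -{1}(prednK (s0 i)) fS prednK.
by rewrite !big_split /= !prodrXr lm prodfV.
Qed.

Lemma exprN1_subz (R : unitRingType) (m l : nat) : (m <= l)%N ->
  (-1 : R) ^ (m%:Z - l%:Z) = (-1) ^+ (l - m).
Proof.
by move=> ml; rewrite -opprB subzn // -exprz_inv invrN1.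
Qed.

Theorem mainTheorem8 (R : realType) (lam : R) (r : nat)
    (hlam : lam <> 0) (hr : (0 < r)%N) (n : nat) :
  gdharm lam (n + r + 1) r =
  \sum_(r + 1 <= l < (n + r + 1).+1)
    (-1) ^ ((r + 1)%:Z - l%:Z) *
    \sum_(s : {ffun 'I_(r + 1) -> 'I_l.+1} |
            [forall i, (0 < s i)%N] && (\sum_i (s i : nat) == l)%N)
      (lam ^+ (l - r - 1) * \prod_i dfall 1 lam^-1 (s i)) /
      \prod_i ((s i)`!)%:R.
Proof.
have lam0 : lam != 0 by apply/eqP.
have := gdharm_genfun lam r; rewrite -[r.+1]addn1.
set G := Fps _ => GE.
rewrite -[LHS]/(fps_coef G n) coef_fps_partial_sum.
(* Substitute [l = i + (r + 1)] with [i] from [0] to [n], to match the partial sum term by term. *)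
rewrite -addnA -addSn -{1}[(r + 1)%N]add0n big_addn addnK big_mkord.
apply: eq_bigr => i _.
(* Multiplying by [fpsX ^+ (r + 1)] moves degree [i] to [i + (r + 1)] and completes the left side of
   [GE]. *)
rewrite -(@coef_fpsXnM _ (r + 1)) mulrA GE coef_dlog1p_exp //.
rewrite exprN1_subz ?leq_addl //.
by congr (_ * _); apply: eq_bigr => s _; rewrite -subnDA.
Qed.
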